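(* Let $G$ be an antipodal distance-regular graph of diameter $3$. Then $G$ has the monotonic normalized heat diffusion property: for any two distinct vertices $u,v$, the function $t\mapsto \frac{H_t(u,v)}{H_t(u,u)}$ is monotonically non-decreasing on $[0,\infty)$.
   Context: All graphs are simple, finite and connected; $L=\mathrm{Deg}-A$ is the graph Laplacian and $H_t=e^{-tL}$ the heat kernel. A connected graph of diameter $D$ is distance-regular if it is $d$-regular and there are constants $b_i,c_i$ such that for any vertices $x,y$ at distance $i$, among the neighbours of $y$ exactly $c_i$ are at distance $i-1$ from $x$ and $b_i$ at distance $i+1$ from $x$; its intersection array is $\{b_0,\dots,b_{D-1};c_1,\dots,c_D\}$ with $b_0=d$. A distance-regular graph of diameter $3$ with intersection array $\{d,b_1,b_2;1,c_2,c_3\}$ is antipodal if $b_2=1$ and $c_3=d$. *)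

(* Defs.v *)
(* MathComp / MathComp-Analysis *)
From HB Require Import structures.
From mathcomp Require Import all_boot all_order all_algebra.
From mathcomp Require Import all_classical all_reals all_analysis.

Set Implicit Arguments.
Unset Strict Implicit.
Unset Printing Implicit Defensive.

Import Order.TTheory GRing.Theory Num.Theory.
Import numFieldNormedType.Exports.

Local Open Scope ring_scope.

Definition simple_connected_graph (T : finType) (e : rel T) : Prop :=
  [/\ symmetric e, irreflexive e & forall x y : T, connect e x y].

Definition walk (T : finType) (e : rel T) (n : nat) (x y : T) : bool :=
  [exists p : n.-tuple T, path e x p && (last x p == y)].

(* [find] returns the least length n < #|T| of a walk from x to y (a shortest
   walk in a connected graph is that short), and #|T| if y is unreachable. *)
Definition gdist (T : finType) (e : rel T) (x y : T) : nat :=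
  find (fun n => walk e n x y) (iota 0 #|T|).

Definition diameter (T : finType) (e : rel T) : nat :=
  (\max_(x : T) \max_(y : T) gdist e x y)%N.

Definition degree (T : finType) (e : rel T) (x : T) : nat :=
  #|[set y | e x y]|.

(* bs = [b_0; ...; b_(D-1)] and cs = [c_1; ...; c_D] is the intersection array
   of a graph of diameter D = size bs.  The numbers left out of the array are
   b_D = 0 (the default value of [nth]) and c_0 = 0 (prepended to cs). *)
Definition distance_regular (T : finType) (e : rel T) (bs cs : seq nat) :
    Prop :=
  [/\ diameter e = size bs,
      size cs = size bs,
      (forall x : T, degree e x = nth 0%N bs 0) &
      forall (i : nat) (x y : T), gdist e x y = i ->
        #|[set z | e y z & (gdist e x z).+1 == i]| = nth 0%N (0%N :: cs) i /\
        #|[set z | e y z & gdist e x z == i.+1]| = nth 0%N bs i].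

Definition antipodal_distance_regular3 (T : finType) (e : rel T) : Prop :=
  exists d b1 b2 c2 c3 : nat,
    [/\ distance_regular e [:: d; b1; b2] [:: 1%N; c2; c3],
        b2 = 1%N & c3 = d].

(* Matrices on the vertex set T are indexed by 'I_#|T| through
   [enum_val] / [enum_rank]. *)
Definition adjmx (R : realType) (T : finType) (e : rel T) : 'M[R]_#|T| :=
  \matrix_(i, j) (e (enum_val i) (enum_val j))%:R.

Definition degmx (R : realType) (T : finType) (e : rel T) : 'M[R]_#|T| :=
  diag_mx (\row_i (degree e (enum_val i))%:R).

Definition laplacian (R : realType) (T : finType) (e : rel T) : 'M[R]_#|T| :=
  degmx R e - adjmx R e.

Definition expmx (R : realType) (n : nat) (A : 'M[R]_n) : 'M[R]_n :=
  (lim (series (fun k => (k`!%:R)^-1 *: A ^+ k) @ \oo))%classic.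

Definition heat_kernel (R : realType) (T : finType) (e : rel T) (t : R)
    (u v : T) : R :=
  expmx (- t *: laplacian R e) (enum_rank u) (enum_rank v).

Definition monotonic_normalized_heat_diffusion (R : realType) (T : finType)
    (e : rel T) : Prop :=
  forall u v : T, u != v ->
    {in `[(0 : R), +oo[ &,
      {homo (fun t : R => heat_kernel e t u v / heat_kernel e t u u) :
        s t / s <= t}}.

(* Main.v *)
(* Let u_i(t) be the value of H_t on pairs at distance i; since the powers of L
   depend only on the distance, (u_0, ..., u_3) solves the linear system of the
   distance partition.  With m = b_1 / c_2 this system splits into two planar
   ones: (w_0, w_1) = (u_0 + m u_3, u_1 + m u_2), the heat flow on the complete
   graph obtained by collapsing antipodal classes, and (p, q) =
   (u_0 - u_3, u_1 - u_2).  The sign of the derivative of u_i / u_0 is that of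
   the Wronskian u_i' u_0 - u_i u_0'.  For i = 3 it is a multiple of
   w_1 p - w_0 q, which is nonnegative by a Gronwall argument; for i = 2 one has
   u_2' >= 0 >= u_0'; for i = 1 the Wronskian is quadratic in m with nonnegative
   coefficients, the middle one because its product with p w_0 is a sum of
   nonnegative terms.  No eigenvalue is ever computed. *)
Require Import Defs.
From HB Require Import structures.
From mathcomp Require Import all_boot all_order all_algebra.
From mathcomp Require Import all_classical all_reals all_analysis.
From mathcomp Require Import ring lra zify.

Set Implicit Arguments.
Unset Strict Implicit.
Unset Printing Implicit Defensive.
Import Order.TTheory GRing.Theory Num.Theory.
Import numFieldNormedType.Exports.
Local Open Scope classical_set_scope.
Local Open Scope ring_scope.

(** * Differential inequalities and monotone quotients *)

Section DifferentialInequalities.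
Variable R : realType.
Implicit Types f g : R -> R.

Lemma derive_ge0_homo f (df : R -> R) :
    (forall t : R, 0 <= t -> is_derive t 1 f (df t)) ->
    (forall t, 0 <= t -> 0 <= df t) ->
  {in `[0, +oo[ &, {homo f : s t / s <= t}}.
Proof.
move=> Df df_ge0 s t; rewrite !in_itv /= !andbT => s0 _ st.
apply: (@ger0_derive1_ndecry _ f 0) => // [x|x|].
- by rewrite in_itv /= andbT => /ltW/Df [].
- rewrite in_itv /= andbT => /ltW x0.
  by rewrite derive1E (derive_val (is_derive := Df x x0)) df_ge0.
- apply: derivable_within_continuous => x; rewrite in_itv /= andbT => /Df[]//.
Qed.

Lemma ratio_homo f g (df dg : R -> R) :
    (forall t : R, is_derive t 1 f (df t)) ->
    (forall t : R, is_derive t 1 g (dg t)) ->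
    (forall t, 0 <= t -> 0 < g t) ->
    (forall t, 0 <= t -> 0 <= df t * g t - f t * dg t) ->
  {in `[0, +oo[ &, {homo (fun t => f t / g t) : s t / s <= t}}.
Proof.
move=> Df Dg g_gt0 W_ge0.
apply: (@derive_ge0_homo _ (fun t => (df t * g t - f t * dg t) / g t ^+ 2)).
  move=> t t0; have gt_neq0 : g t != 0 by rewrite gt_eqF// g_gt0.
  apply: (is_derive_eq (is_deriveM (Df t) (is_deriveV gt_neq0 (Dg t)))).
  rewrite /GRing.scale /=; field.
  exact: gt_neq0.
by move=> t t0; rewrite divr_ge0 ?W_ge0 ?sqr_ge0.
Qed.

(** Integrating factor: [f t * expR (c * t)] has derivative [(df t + c * f t) * expR (c * t)]. *)
Lemma gronwall_le (c : R) f (df : R -> R) :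
    (forall t : R, is_derive t 1 f (df t)) ->
    (forall t, 0 <= t -> 0 <= df t + c * f t) ->
  forall t, 0 <= t -> f 0 <= f t * expR (c * t).
Proof.
move=> Df src_ge0 t t0.
suff : {in `[0, +oo[ &, {homo f * (expR \o ( *%R c)) : s t / s <= t}}.
  move=> /(_ 0 t); rewrite !in_itv /= !andbT lexx => /(_ isT t0 t0).
  by rewrite !fctE /= mulr0 expR0 mulr1.
apply: (@derive_ge0_homo _ (fun t => (df t + c * f t) * expR (c * t))).
  move=> x _; have Dc : is_derive x (1 : R) ( *%R c) c.
    apply: (is_derive_eq (is_deriveZ c (is_derive_id x (1 : R)))).
    by rewrite /GRing.scale /= mulr1.
  apply: (is_derive_eq (is_deriveM (Df x) (is_derive1_comp _ Dc))).
  by rewrite /GRing.scale /=; ring.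
by move=> x x0; rewrite mulr_ge0 ?expR_ge0 ?src_ge0.
Qed.

Lemma gronwall_ge0 (c : R) f (df : R -> R) :
    (forall t : R, is_derive t 1 f (df t)) ->
    (forall t, 0 <= t -> 0 <= df t + c * f t) ->
  0 <= f 0 -> forall t, 0 <= t -> 0 <= f t.
Proof.
move=> Df src_ge0 f0 t t0; rewrite -(pmulr_lge0 _ (expR_gt0 (c * t))).
exact: le_trans f0 (gronwall_le Df src_ge0 t0).
Qed.

Lemma gronwall_gt0 (c : R) f (df : R -> R) :
    (forall t : R, is_derive t 1 f (df t)) ->
    (forall t, 0 <= t -> 0 <= df t + c * f t) ->
  0 < f 0 -> forall t, 0 <= t -> 0 < f t.
Proof.
move=> Df src_ge0 f0 t t0; rewrite -(pmulr_lgt0 _ (expR_gt0 (c * t))).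
exact: lt_le_trans f0 (gronwall_le Df src_ge0 t0).
Qed.

Lemma neq0_gt0 f : continuous f -> (forall t, 0 <= t -> f t != 0) ->
  0 < f 0 -> forall t, 0 <= t -> 0 < f t.
Proof.
move=> cf f_neq0 f0 t t0; rewrite ltNge; apply/negP => ft_le0.
have [|c] := @IVT R f 0 t 0 t0 (continuous_subspaceT cf).
  by rewrite ge_min le_max ft_le0 (ltW f0) orbT.
by rewrite in_itv /= => /andP[c0 _] /eqP; apply/negP/f_neq0.
Qed.

End DifferentialInequalities.

(** * The linear system on the four distance classes *)

Section AntipodalODE.
Variables (R : realType) (d b c : R) (u0 u1 u2 u3 : R -> R).
Implicit Types t : R.
Hypotheses (d_ge0 : 0 <= d) (b_ge0 : 0 <= b) (c_gt0 : 0 < c).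
Hypothesis Du0 : forall t : R, is_derive t 1 u0 (d * (u1 t - u0 t)).
Hypothesis Du1 :
  forall t : R, is_derive t 1 u1 (u0 t - u1 t + b * (u2 t - u1 t)).
Hypothesis Du2 :
  forall t : R, is_derive t 1 u2 (c * (u1 t - u2 t) + (u3 t - u2 t)).
Hypothesis Du3 : forall t : R, is_derive t 1 u3 (d * (u2 t - u3 t)).
Hypotheses (u0_0 : u0 0 = 1) (u1_0 : u1 0 = 0).
Hypotheses (u2_0 : u2 0 = 0) (u3_0 : u3 0 = 0).

(** In the graph, [m] is the number of vertices at distance 3 from a given one, so [w0] is the total
    heat on the antipodal class of the source and [w1] that on any other class. *)
Let m := b / c.
Let s := 1 + b + c.
Let p := u0 - u3.
Let q := u1 - u2.
Let w0 := u0 + m *: u3.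
Let w1 := u1 + m *: u2.

Let m_ge0 : 0 <= m. Proof. by rewrite divr_ge0// ltW. Qed.
Let b_mc : b = m * c. Proof. by rewrite /m divfK// gt_eqF. Qed.

Let Dp (t : R) : is_derive t 1 p (d * (q t - p t)).
Proof.
apply: (is_derive_eq (is_deriveB (Du0 t) (Du3 t))).
by rewrite /p /q !fctE; ring.
Qed.

Let Dq (t : R) : is_derive t 1 q (p t - s * q t).
Proof.
apply: (is_derive_eq (is_deriveB (Du1 t) (Du2 t))).
by rewrite /p /q /s !fctE; ring.
Qed.

Let Dw0 (t : R) : is_derive t 1 w0 (d * (w1 t - w0 t)).
Proof.
apply: (is_derive_eq (is_deriveD (Du0 t) (is_deriveZ m (Du3 t)))).
by rewrite /w0 /w1 !fctE /GRing.scale /=; ring.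
Qed.

Let Dw1 (t : R) : is_derive t 1 w1 (w0 t - w1 t).
Proof.
apply: (is_derive_eq (is_deriveD (Du1 t) (is_deriveZ m (Du2 t)))).
by rewrite /w0 /w1 !fctE /GRing.scale /= b_mc; ring.
Qed.

Let p0 : p 0 = 1. Proof. by rewrite /p !fctE u0_0 u3_0 subr0. Qed.
Let q0 : q 0 = 0. Proof. by rewrite /q !fctE u1_0 u2_0 subr0. Qed.
Let w00 : w0 0 = 1. Proof. by rewrite /w0 !fctE u0_0 u3_0 scaler0 addr0. Qed.
Let w10 : w1 0 = 0. Proof. by rewrite /w1 !fctE u1_0 u2_0 scaler0 addr0. Qed.

(** The gap solves [f' = - (d + 1) * f] exactly; [d + 1] is the nonzero Laplacian eigenvalue of the
    complete graph on [d + 1] vertices. *)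
Let w_gap t : 0 <= t -> 0 < w0 t - w1 t.
Proof.
apply: (@gronwall_gt0 _ (d + 1) (w0 - w1) _
  (fun t => is_deriveB (Dw0 t) (Dw1 t))) t.
  by move=> t _; rewrite !fctE le_eqVlt; apply/orP; left; apply/eqP; ring.
by rewrite !fctE w00 w10 subr0.
Qed.

Let w1_ge0 t : 0 <= t -> 0 <= w1 t.
Proof.
apply: (@gronwall_ge0 _ 0 w1 _ Dw1) t; last by rewrite w10.
by move=> t t0; rewrite mul0r addr0 ltW// w_gap.
Qed.

Let w0_gt0 t : 0 <= t -> 0 < w0 t.
Proof. by move=> t0; have := w_gap t0; have := w1_ge0 t0; lra. Qed.

(* This is [q' p - q p'], so by Liouville it equals [expR (- (d + s) * t)]. *)
Let wronskian_pq t : 0 <= t ->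
  0 < p t * p t + (d - s) * (p t * q t) - d * (q t * q t).
Proof.
have DJ (x : R) : is_derive x 1 (p * p + (d - s) *: (p * q) - d *: (q * q))
    (- (d + s) * (p x * p x + (d - s) * (p x * q x) - d * (q x * q x))).
  apply: (is_derive_eq (is_deriveB (is_deriveD (is_deriveM (Dp x) (Dp x))
    (is_deriveZ (d - s) (is_deriveM (Dp x) (Dq x))))
    (is_deriveZ d (is_deriveM (Dq x) (Dq x))))).
  by rewrite /GRing.scale /=; ring.
apply: (@gronwall_gt0 _ (d + s) _ _ DJ) t.
  by move=> t _; rewrite !fctE /GRing.scale /= le_eqVlt; apply/orP; left;
    apply/eqP; ring.
by rewrite !fctE p0 q0 /GRing.scale /=; lra.
Qed.

(** Gronwall on [p] would be circular, as its source [d * q] gets its sign from [p]. Instead, at a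
    zero of [p] the form in [wronskian_pq] would be [- d * q ^ 2 <= 0], so [p] never vanishes. *)
Let p_gt0 t : 0 <= t -> 0 < p t.
Proof.
apply: neq0_gt0 t; last by rewrite p0.
  by move=> t; apply/differentiable_continuous/derivable1_diffP; case: (Dp t).
move=> t t0; apply/eqP => pt0; have := wronskian_pq t0.
by rewrite pt0 !mul0r mulr0 !add0r oppr_gt0 ltNge mulr_ge0 // -expr2 sqr_ge0.
Qed.

Let q_ge0 t : 0 <= t -> 0 <= q t.
Proof.
apply: (@gronwall_ge0 _ s q _ Dq) t; last by rewrite q0.
by move=> t t0; rewrite subrK ltW// p_gt0.
Qed.

Let q_le_p t : 0 <= t -> 0 <= p t - q t.
Proof.
apply: (@gronwall_ge0 _ (d + 1) (p - q) _
  (fun t => is_deriveB (Dp t) (Dq t))) t.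
  move=> t t0; rewrite !fctE (_ : _ + _ = (b + c) * q t); last first.
    by rewrite /s; ring.
  by rewrite mulr_ge0 ?q_ge0 ?addr_ge0 ?(ltW c_gt0).
by rewrite !fctE p0 q0 subr0.
Qed.

(** The rate [d + 1] cancels the [w1 * p] terms and leaves the source [(b + c) * (w0 * q)]. *)
Let wp_ge_wq t : 0 <= t -> 0 <= w1 t * p t - w0 t * q t.
Proof.
apply: (@gronwall_ge0 _ (d + 1) (w1 * p - w0 * q) _ (fun t =>
  is_deriveB (is_deriveM (Dw1 t) (Dp t)) (is_deriveM (Dw0 t) (Dq t)))) t.
  move=> t t0; rewrite !fctE (_ : _ + _ = (b + c) * (w0 t * q t)); last first.
    by rewrite /s /GRing.scale /=; ring.
  have wq_ge0 : 0 <= w0 t * q t by rewrite mulr_ge0 ?q_ge0// ltW// w0_gt0.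
  by rewrite mulr_ge0// addr_ge0// ltW.
by rewrite !fctE p0 q0 w10 !mul0r mulr0 subrr.
Qed.

(** The derivative of [u2] vanishes at 0 and itself satisfies a Gronwall inequality at rate
    [d + 1]. *)
Let u2'_ge0 t : 0 <= t -> 0 <= c * (u1 t - u2 t) + (u3 t - u2 t).
Proof.
apply: (@gronwall_ge0 _ (d + 1) (c *: q + (u3 - u2)) _ (fun t =>
  is_deriveD (is_deriveZ c (Dq t)) (is_deriveB (Du3 t) (Du2 t)))) t; last first.
  by rewrite !fctE q0 u2_0 u3_0 scaler0 subrr addr0.
move=> t t0; rewrite !fctE.
rewrite [leRHS](_ : _ = c * (p t + (d - s) * q t)); last first.
  by rewrite /p /q /s /GRing.scale /= !fctE; ring.
(* Multiplied by [p], the factor [p + (d - s) * q] is the positive form of [wronskian_pq] plus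
   [d * q ^ 2]. *)
rewrite mulr_ge0 ?(ltW c_gt0)// -(pmulr_rge0 _ (p_gt0 t0)).
have := ltW (wronskian_pq t0); have : 0 <= d * (q t * q t).
  by rewrite mulr_ge0// -expr2 sqr_ge0.
nra.
Qed.

(* [w1' p - w1 p' + q' w0 - q w0'], the coefficient of [m] in the Wronskian of
   [u1] and [u0]. *)
Let cross_ge0 t : 0 <= t ->
  0 <= 2 * (w0 t * p t) + (d - 1) * (w1 t * p t) + (d - s) * (w0 t * q t)
       - 2 * d * (w1 t * q t).
Proof.
move=> t0; have wp_gt0 : 0 < w0 t * p t by rewrite mulr_gt0 ?w0_gt0 ?p_gt0.
rewrite -(pmulr_rge0 _ wp_gt0).
rewrite [leRHS](_ : _ = w0 t ^+ 2 *
    (p t * p t + (d - s) * (p t * q t) - d * (q t * q t)) +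
    p t ^+ 2 * ((w0 t - w1 t) * (w0 t + d * w1 t)) +
    d * (w1 t * p t - w0 t * q t) ^+ 2); last by ring.
have wsum_ge0 : 0 <= w0 t + d * w1 t.
  by rewrite addr_ge0 ?(ltW (w0_gt0 t0))// mulr_ge0 ?w1_ge0.
rewrite addr_ge0 ?addr_ge0//.
- by rewrite mulr_ge0 ?sqr_ge0 ?(ltW (wronskian_pq t0)).
- by rewrite mulr_ge0 ?sqr_ge0// mulr_ge0 ?(ltW (w_gap t0)).
- by rewrite mulr_ge0 ?sqr_ge0.
Qed.

Let m1_gt0 : 0 < 1 + m. Proof. by rewrite ltr_pwDl. Qed.

Let u0E t : u0 t = (w0 t + m * p t) / (1 + m).
Proof. by rewrite /w0 /p !fctE /GRing.scale /=; field; rewrite gt_eqF. Qed.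
Let u1E t : u1 t = (w1 t + m * q t) / (1 + m).
Proof. by rewrite /w1 /q !fctE /GRing.scale /=; field; rewrite gt_eqF. Qed.
Let u2E t : u2 t = (w1 t - q t) / (1 + m).
Proof. by rewrite /w1 /q !fctE /GRing.scale /=; field; rewrite gt_eqF. Qed.
Let u3E t : u3 t = (w0 t - p t) / (1 + m).
Proof. by rewrite /w0 /p !fctE /GRing.scale /=; field; rewrite gt_eqF. Qed.

Let u0_gt0 t : 0 <= t -> 0 < u0 t.
Proof.
by move=> t0; rewrite u0E divr_gt0// ltr_pwDl ?w0_gt0// mulr_ge0// ltW// p_gt0.
Qed.

Let u1_le_u0 t : 0 <= t -> 0 <= u0 t - u1 t.
Proof.
move=> t0; rewrite u0E u1E.
rewrite (_ : _ - _ = (w0 t - w1 t + m * (p t - q t)) / (1 + m)); last by ring.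
rewrite divr_ge0 ?(ltW m1_gt0)// addr_ge0 ?(ltW (w_gap t0))//.
by rewrite mulr_ge0// q_le_p.
Qed.

Let u2_ge0 t : 0 <= t -> 0 <= u2 t.
Proof.
apply: (@gronwall_ge0 _ 0 u2 _ Du2) t; last by rewrite u2_0.
by move=> t t0; rewrite mul0r addr0 u2'_ge0.
Qed.

Lemma ode_ratio1 :
  {in `[0, +oo[ &, {homo (fun t => u1 t / u0 t) : r t / r <= t}}.
Proof.
apply: (ratio_homo Du1 Du0) u0_gt0 _ => t t0.
(* Expansion in powers of [m]: the constant term is the Wronskian of [w1] and [w0], the top
   coefficient that of [q] and [p]. *)
rewrite [leRHS](_ : _ = ((w0 t - w1 t) * (w0 t + d * w1 t) + m *
   (2 * (w0 t * p t) + (d - 1) * (w1 t * p t) + (d - s) * (w0 t * q t)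
       - 2 * d * (w1 t * q t)) + m ^+ 2 *
   (p t * p t + (d - s) * (p t * q t) - d * (q t * q t))) / (1 + m) ^+ 2).
  rewrite divr_ge0 ?sqr_ge0// !addr_ge0//.
  - rewrite mulr_ge0 ?(ltW (w_gap t0))//.
    by rewrite addr_ge0 ?(ltW (w0_gt0 t0))// mulr_ge0 ?w1_ge0.
  - by rewrite mulr_ge0 ?cross_ge0.
  - by rewrite mulr_ge0 ?sqr_ge0 ?(ltW (wronskian_pq t0)).
rewrite u0E u1E u2E /s b_mc; field.
by rewrite gt_eqF.
Qed.

Lemma ode_ratio2 :
  {in `[0, +oo[ &, {homo (fun t => u2 t / u0 t) : r t / r <= t}}.
Proof.
apply: (ratio_homo Du2 Du0) u0_gt0 _ => t t0.
rewrite subr_ge0 (@le_trans _ _ 0)//.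
  by rewrite mulr_ge0_le0 ?u2_ge0// mulr_ge0_le0// -oppr_ge0 opprB u1_le_u0.
by rewrite mulr_ge0 ?u2'_ge0// ltW// u0_gt0.
Qed.

Lemma ode_ratio3 :
  {in `[0, +oo[ &, {homo (fun t => u3 t / u0 t) : r t / r <= t}}.
Proof.
apply: (ratio_homo Du3 Du0) u0_gt0 _ => t t0.
(* The terms in [u0 * u3] cancel, so the Wronskian is [d * (u0 * u2 - u1 * u3)]. *)
rewrite [leRHS](_ : _ = d * (w1 t * p t - w0 t * q t) / (1 + m)).
  by rewrite divr_ge0 ?(ltW m1_gt0)// mulr_ge0// wp_ge_wq.
rewrite u0E u1E u2E u3E; field.
by rewrite gt_eqF.
Qed.

End AntipodalODE.

(** * Exponential generating series and the matrix exponential *)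

Section ExponentialSeries.
Variable R : realType.
Implicit Types (a : nat -> R) (B C t : R).

Definition egf_coeff a : nat -> R := fun k => (k`!%:R)^-1 * a k.

Definition egf a t : R := limn (pseries (egf_coeff a) t).

Lemma is_cvg_egf a B C t : (forall k, `|a k| <= B * C ^+ k) ->
  cvgn (pseries (egf_coeff a) t).
Proof.
move=> aB; have C' k : B * C ^+ k <= `|B| * `|C| ^+ k.
  by rewrite -normrX -normrM ler_norm.
apply: normed_cvg; rewrite /normed_series_of /=.
apply: (@series_le_cvg _ _ (`|B| *: exp_coeff (`|C| * `|t|))) => [k|k|k|].
- by [].
- by rewrite !fctE mulr_ge0// exp_coeff_ge0// mulr_ge0.
- rewrite !fctE /exp_coeff /egf_coeff /GRing.scale /= !normrM normfV normrX.
  rewrite normr_nat exprMn.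
  rewrite [leRHS](_ : _ = k`!%:R^-1 * (`|B| * `|C| ^+ k) * `|t| ^+ k);
    last by ring.
  rewrite ler_wpM2r ?exprn_ge0// ler_wpM2l ?invr_ge0 ?ler0n//.
  exact: le_trans (aB k) (C' k).
- exact/is_cvg_seriesZ/is_cvg_series_exp_coeff.
Qed.

(** The factor [k + 1] from differentiation cancels against [(k + 1)!]: differentiating shifts the
    sequence. *)
Lemma pseries_diffs_egf a :
  pseries_diffs (egf_coeff a) = egf_coeff (fun k => a k.+1).
Proof.
apply/funext => k; rewrite /pseries_diffs /egf_coeff factS natrM invfM.
by rewrite -mulrA mulVKf// pnatr_eq0.
Qed.

Lemma is_derive_egf a B C t : (forall k, `|a k| <= B * C ^+ k) ->
  is_derive t 1 (egf a) (egf (fun k => a k.+1) t).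
Proof.
move=> aB; have aB1 k : `|a k.+1| <= (B * C) * C ^+ k.
  by rewrite -mulrA -exprS.
have aB2 k : `|a k.+2| <= (B * C * C) * C ^+ k by rewrite -mulrA -exprS.
rewrite /egf -pseries_diffs_egf.
(* Termwise differentiation asks that the series and its first two derived series converge at a
   point of modulus larger than [|t|]; each shift only multiplies [B] by [C]. *)
apply: (@pseries_snd_diffs _ _ (`|t| + 1)).
- exact: is_cvg_egf aB.
- by rewrite pseries_diffs_egf; exact: is_cvg_egf aB1.
- rewrite !pseries_diffs_egf; exact: is_cvg_egf aB2.
- by rewrite (@ger0_norm _ (_ + 1)) ?addr_ge0// ltrDl.
Qed.

Lemma egf0 a : egf a 0 = a 0%N.
Proof.
rewrite /egf; apply: lim_near_cst => //; near=> n.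
(* Partial sums of positive length equal [a 0], with [0 ^ 0 = 1]; the empty one is 0, hence the
   restriction to large [n]. *)
rewrite -[n]prednK; last by near: n.
rewrite /pseries /series /= big_nat_recl//= big1 => [|i _].
  by rewrite /egf_coeff fact0 invr1 expr0 !(mul1r, mulr1) addr0.
by rewrite expr0n mulr0.
Unshelve. all: by end_near. Qed.

Lemma egf_lin (x y : R) a1 a2 B1 C1 B2 C2 t :
    (forall k, `|a1 k| <= B1 * C1 ^+ k) ->
    (forall k, `|a2 k| <= B2 * C2 ^+ k) ->
  egf (fun k => x * a1 k + y * a2 k) t = x * egf a1 t + y * egf a2 t.
Proof.
move=> /(is_cvg_egf (t := t)) c1 /(is_cvg_egf (t := t)) c2.
apply: cvg_lim => //.
rewrite (_ : pseries _ t =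
    x *: pseries (egf_coeff a1) t + y *: pseries (egf_coeff a2) t).
  by apply: cvgD; [exact: cvgM (cvg_cst x) c1 | exact: cvgM (cvg_cst y) c2].
apply/funext => n; rewrite /pseries /series /= !fctE /GRing.scale /= !mulr_sumr.
by rewrite -big_split; apply: eq_bigr => i _; rewrite /egf_coeff /=; ring.
Qed.

(** With finitely many entries, the entrywise conditions eventually hold simultaneously. *)
Lemma cvg_mx m n (f : nat -> 'M[R]_(m, n)) (A : 'M[R]_(m, n)) :
  (forall i j, f k i j @[k --> \oo] --> A i j) ->
  f k @[k --> \oo] --> A.
Proof.
move=> fA S [P AP PS]; rewrite /nbhs /=.
have : \forall k \near \oo, forall i j, P i j (f k i j).
  apply: filter_forall => i; apply: filter_forall => j.
  exact: fA (AP i j).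
by apply: filterS => k; exact: PS.
Qed.

Lemma scalemx_exp n (M : 'M[R]_n) t k : (t *: M) ^+ k = t ^+ k *: M ^+ k.
Proof.
elim: k => [|k IHk]; first by rewrite !expr0 scale1r.
by rewrite !exprS IHk -!mulmxE -scalemxAl -scalemxAr scalerA.
Qed.

Lemma expmx_egf n (M : 'M[R]_n) t B C i j :
    (forall i j k, `|(M ^+ k) i j| <= B * C ^+ k) ->
  expmx (t *: M) i j = egf (fun k => (M ^+ k) i j) t.
Proof.
move=> MB; pose E := \matrix_(i, j) egf (fun k => (M ^+ k) i j) t.
suff -> : expmx (t *: M) = E by rewrite mxE.
apply: cvg_lim; first exact: norm_hausdorff.
apply: cvg_mx => {}i {}j; rewrite mxE.
have := is_cvg_egf (t := t) (MB i j); rewrite /egf.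
rewrite (_ : pseries _ t = fun k =>
  series (fun k => (k`!%:R)^-1 *: (t *: M) ^+ k) k i j); first exact.
apply/funext => k; rewrite /pseries /series /= summxE; apply: eq_bigr => l _.
by rewrite /egf_coeff scalemx_exp !mxE mulrCA mulrC.
Qed.

End ExponentialSeries.

(** * Graph distance and shortest walks *)

Section GraphDistance.
Variables (T : finType) (e : rel T).

Lemma walkP n x y :
  reflect (exists p, [/\ size p = n, path e x p & last x p = y]) (walk e n x y).
Proof.
apply: (iffP existsP) => [[p /andP[xp /eqP py]]|[p [sz_p xp py]]].
  by exists p; rewrite size_tuple.
have sp : size p == n by apply/eqP.
by exists (Tuple sp); rewrite /= xp py eqxx.
Qed.

Lemma gdist_le_walk n x y : walk e n x y -> (gdist e x y <= n)%N.
Proof.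
(* A failed search returns [#|T|], so minimality of [find] matters only for [n < #|T|]. *)
move=> w; have [nT|Tn] := ltnP n #|T|; last first.
  apply: leq_trans Tn.
  by rewrite /gdist (leq_trans (find_size _ _))// size_iota.
rewrite leqNgt; apply/negP => /(before_find 0%N).
by rewrite nth_iota// add0n w.
Qed.

Lemma gdist_refl x : gdist e x x = 0%N.
Proof.
by apply/eqP; rewrite -leqn0 gdist_le_walk//; apply/walkP; exists [::].
Qed.

Lemma gdist_le_diameter x y : (gdist e x y <= diameter e)%N.
Proof.
apply: leq_trans (leq_bigmax x); exact: (leq_bigmax (F := gdist e x) y).
Qed.

Hypothesis e_conn : forall x y, connect e x y.

(** A connecting path shortens to a duplicate-free one, of length below [#|T|], so the bounded
    search succeeds. *)
Lemma gdist_walk x y : walk e (gdist e x y) x y.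
Proof.
have [p xp ->] := connectP (e_conn x y).
case/shortenP: xp => p' xp' /card_uniqP sz_p' _.
have szT : (size p' < #|T|)%N.
  by rewrite -ltnS -[(size p').+1]sz_p' ltnS max_card.
have hw : has (fun n => walk e n x (last x p')) (iota 0 #|T|).
  apply/hasP; exists (size p'); first by rewrite mem_iota.
  by apply/walkP; exists p'.
have := nth_find 0%N hw; rewrite nth_iota//.
by rewrite -[X in (_ < X)%N](size_iota 0 #|T|) -has_find.
Qed.

Lemma gdist_eq0 x y : (gdist e x y == 0%N) = (x == y).
Proof.
apply/eqP/eqP => [d0|->]; last exact: gdist_refl.
by have /walkP[p []] := gdist_walk x y; rewrite d0 => /size0nil -> _ /= ->.
Qed.

Lemma gdist_step x y z : e y z -> (gdist e x z <= (gdist e x y).+1)%N.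
Proof.
move=> yz; apply: gdist_le_walk; have /walkP[p [sz xp py]] := gdist_walk x y.
apply/walkP; exists (rcons p z).
by rewrite size_rcons sz rcons_path xp py yz last_rcons.
Qed.

(** Drop the last vertex of a shortest walk; by [gdist_step] the vertex before it cannot be any
    nearer to [x]. *)
Lemma gdist_pred x y n : gdist e x y = n.+1 ->
  exists2 z, e z y & gdist e x z = n.
Proof.
move=> dxy; have /walkP[p []] := gdist_walk x y; rewrite dxy.
case/lastP: p => // p y'; rewrite size_rcons rcons_path last_rcons.
move=> [sz] /andP[xp zy'] yy'; rewrite {y'}yy' in zy'.
exists (last x p) => //; apply/eqP; rewrite eqn_leq.
rewrite gdist_le_walk /=; last by apply/walkP; exists p.
by have := gdist_step x zy'; rewrite dxy ltnS.
Qed.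

End GraphDistance.

(** A positive diameter rules out the empty vertex type, where the maximum is 0 but no pair attains
    it. *)
Lemma exists_gdist_diameter (T : finType) (e : rel T) n :
  diameter e = n.+1 -> exists x y, gdist e x y = n.+1.
Proof.
move=> diam; have [/existsP[x /existsP[y /eqP xy]]|] :=
  boolP [exists x, exists y, gdist e x y == n.+1]; first by exists x, y.
move=> /existsPn noxy; suff : (diameter e <= n)%N by rewrite diam ltnn.
apply/bigmax_leqP => x _; apply/bigmax_leqP => y _.
have := gdist_le_diameter e x y; rewrite diam leq_eqVlt ltnS.
by have /existsPn/(_ y)/negPf -> := noxy x.
Qed.

(** * The heat kernel as a function of distance *)

Section DistanceRegular.
Variables (R : realType) (T : finType) (e : rel T) (bs cs : seq nat).
Hypothesis (e_graph : simple_connected_graph e).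
Hypothesis (e_dr : distance_regular e bs cs).

Let b i : R := (nth 0%N bs i)%:R.
Let c i : R := (nth 0%N (0%N :: cs) i)%:R.

(** The entry of [(- L) ^+ k] at distance [i], computed in the quotient of [- L] by the distance
    partition. At the diameter the default [b i = 0] removes the reference to [i.+1]. *)
Fixpoint lap_coeff k i : R :=
  if k is k'.+1 then
    c i * (lap_coeff k' i.-1 - lap_coeff k' i) +
    b i * (lap_coeff k' i.+1 - lap_coeff k' i)
  else (i == 0%N)%:R.

(** An edge changes the distance to [x] by at most one, and neighbours of [y] at equal distance
    contribute zero. *)
Lemma sum_gdist_neighbours (f : nat -> R) x y :
  \sum_(z | e y z) (f (gdist e x z) - f (gdist e x y)) =
    c (gdist e x y) * (f (gdist e x y).-1 - f (gdist e x y)) +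
    b (gdist e x y) * (f (gdist e x y).+1 - f (gdist e x y)).
Proof.
have [e_sym _ e_conn] := e_graph; have [_ _ _ count_nbr] := e_dr.
set i := gdist e x y; have [cE bE] := count_nbr i x y erefl.
rewrite /c /b -cE -bE -!sum1_card !natr_sum !mulr_suml.
rewrite big_mkcond [X in _ = X + _]big_mkcond [X in _ = _ + X]big_mkcond.
rewrite -big_split; apply: eq_bigr => z _ /=; rewrite !inE !mul1r.
case: ifP => yz /=; last by rewrite addr0.
have := gdist_step e_conn x yz; rewrite -/i.
rewrite e_sym in yz; have := gdist_step e_conn x yz; rewrite -/i.
have [->|ne1] := eqVneq (gdist e x z) i.+1.
  by rewrite gtn_eqF ?add0r// ltnS.
have [<-|ne2] := eqVneq (gdist e x z).+1 i; first by rewrite addr0.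
move=> le1 le2; rewrite (_ : gdist e x z = i) ?subrr ?addr0//.
by move: ne1 ne2 le1 le2; move: (gdist _ _ _); lia.
Qed.

Lemma laplacian_expE k x y :
  ((- laplacian R e) ^+ k) (enum_rank x) (enum_rank y) =
  lap_coeff k (gdist e x y).
Proof.
have [e_sym _ e_conn] := e_graph.
elim: k x y => [|k IHk] x y.
  by rewrite expr0 mxE (inj_eq enum_rank_inj) /= gdist_eq0.
rewrite exprSr mxE (reindex _ (onW_bij _ (@enum_rank_bij T))) /=.
rewrite -sum_gdist_neighbours.
under eq_bigr => z _ do rewrite IHk !mxE !enum_rankK (inj_eq enum_rank_inj)
  opprB mulrBr.
rewrite !sumrB; congr (_ - _).
  rewrite [RHS]big_mkcond; apply: eq_bigr => z _; rewrite e_sym.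
  by case: (e y z); rewrite ?mulr1 ?mulr0.
rewrite (bigD1 y)//= big1 => [|z /negPf zy]; last by rewrite zy mulr0n mulr0.
rewrite eqxx mulr1n addr0 sumr_const /degree mulr_natr; congr (_ *+ _).
by apply: eq_card => z; rewrite inE.
Qed.

Lemma lap_coeff_bound :
  exists C, forall k i, `|lap_coeff k i| <= C ^+ k.
Proof.
have nth_le (s : seq nat) i : (nth 0%N s i <= sumn s)%N.
  elim: s i => [|n s IHs] [|i] //=; first exact: leq_addr.
  exact: leq_trans (IHs i) (leq_addl _ _).
(* Each [b i] or [c i] is at most the sum of its list; the factor 2 pays for a difference of two
   earlier values. *)
exists ((sumn cs + sumn bs)%:R * 2); elim=> [|k IHk] i /=.
  by case: (i == 0%N); rewrite ?normr1 ?normr0 expr0 ?ler01.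
set C := _ * 2 in IHk *.
have diff i1 i2 : `|lap_coeff k i1 - lap_coeff k i2| <= 2 * C ^+ k.
  by rewrite (le_trans (ler_normB _ _))// mulr_natl mulr2n lerD.
rewrite exprS {1}/C natrD mulrDl mulrDl -!mulrA (le_trans (ler_normD _ _))//.
by rewrite !normrM !normr_nat lerD// ler_pM// ler_nat ?nth_le//.
Qed.

Definition heat_coeff i : R -> R := egf (fun k => lap_coeff k i).

Lemma heat_kernelE t x y : heat_kernel e t x y = heat_coeff (gdist e x y) t.
Proof.
have [C aC] := lap_coeff_bound.
have LC i j k : `|((- laplacian R e) ^+ k) i j| <= 1 * C ^+ k.
  by rewrite -[i]enum_valK -[j]enum_valK laplacian_expE mul1r.
rewrite /heat_kernel scaleNr -scalerN (expmx_egf _ _ _ LC).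
by congr egf; apply/funext => k; rewrite laplacian_expE.
Qed.

Lemma is_derive_heat_coeff i (t : R) : is_derive t 1 (heat_coeff i)
  (c i * (heat_coeff i.-1 t - heat_coeff i t) +
   b i * (heat_coeff i.+1 t - heat_coeff i t)).
Proof.
have [C aC] := lap_coeff_bound.
have aC1 j k : `|lap_coeff k j| <= 1 * C ^+ k by rewrite mul1r.
have diffE j1 j2 :
    egf (fun k => 1 * lap_coeff k j1 + (-1) * lap_coeff k j2) t =
    heat_coeff j1 t - heat_coeff j2 t.
  by rewrite (egf_lin _ _ _ (aC1 j1) (aC1 j2)) mul1r mulN1r.
have diffC j1 j2 k :
    `|1 * lap_coeff k j1 + (-1) * lap_coeff k j2| <= 2 * C ^+ k.
  rewrite mul1r mulN1r (le_trans (ler_normB _ _))//.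
  by rewrite mulr_natl mulr2n lerD.
apply: (is_derive_eq (is_derive_egf _ (aC1 i))).
(* The derivative shifts [k], and the recursion of [lap_coeff] writes the shifted sequence as a
   combination of differences. *)
rewrite -!diffE -(egf_lin _ _ _ (diffC _ _) (diffC _ _)).
by congr egf; apply/funext => k /=; rewrite !mul1r !mulN1r.
Qed.

Lemma heat_coeff0 i : heat_coeff i 0 = (i == 0%N)%:R.
Proof. by rewrite /heat_coeff egf0. Qed.

End DistanceRegular.

(** On a shortest walk to a vertex at distance 3, the vertex at distance 1 is counted by [c2] at the
    vertex at distance 2. This permits the division in [m = b1 / c2]. *)
Lemma diameter3_c2_gt0 (T : finType) (e : rel T) d b1 b2 c2 c3 :
    simple_connected_graph e ->
    distance_regular e [:: d; b1; b2] [:: 1%N; c2; c3] ->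
  (0 < c2)%N.
Proof.
move=> [e_sym _ e_conn] [diam _ _ count_nbr].
have [x [y3 d3]] := exists_gdist_diameter diam.
have [y2 _ d2] := gdist_pred e_conn d3.
have [y1 y12 d1] := gdist_pred e_conn d2.
have [/= <- _] := count_nbr 2%N x y2 d2.
by apply/card_gt0P; exists y1; rewrite inE e_sym y12 d1.
Qed.

Theorem theorem3 (R : realType) (T : finType) (e : rel T)
    (He : simple_connected_graph e) (Hanti : antipodal_distance_regular3 e) :
  monotonic_normalized_heat_diffusion R e.
Proof.
have [d [b1 [b2 [c2 [c3 [dr b2E c3E]]]]]] := Hanti.
rewrite {b2}b2E {c3}c3E {Hanti} in dr.
have c2_gt0 : 0 < c2%:R :> R by rewrite ltr0n (diameter3_c2_gt0 He dr).
have [_ _ e_conn] := He; have [diam _ _ _] := dr.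
pose u i := @heat_coeff R [:: d; b1; 1%N] [:: 1%N; c2; d] i.
have Du i t := is_derive_heat_coeff [:: d; b1; 1%N] [:: 1%N; c2; d] i (t : R).
(* The general system for this array, with the unlisted [c_0] and [b_3] equal to 0. *)
have Du0 (t : R) : is_derive t 1 (u 0%N) (d%:R * (u 1%N t - u 0%N t)).
  by apply: (is_derive_eq (Du _ _)); rewrite /u /=; ring.
have Du1 (t : R) : is_derive t 1 (u 1%N)
    (u 0%N t - u 1%N t + b1%:R * (u 2%N t - u 1%N t)).
  by apply: (is_derive_eq (Du _ _)); rewrite /u /=; ring.
have Du2 (t : R) : is_derive t 1 (u 2%N)
    (c2%:R * (u 1%N t - u 2%N t) + (u 3%N t - u 2%N t)).
  by apply: (is_derive_eq (Du _ _)); rewrite /u /=; ring.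
have Du3 (t : R) : is_derive t 1 (u 3%N) (d%:R * (u 2%N t - u 3%N t)).
  by apply: (is_derive_eq (Du _ _)); rewrite /u /=; ring.
have u00 : u 0%N 0 = 1 by rewrite /u heat_coeff0.
have u10 : u 1%N 0 = 0 by rewrite /u heat_coeff0.
have u20 : u 2%N 0 = 0 by rewrite /u heat_coeff0.
have u30 : u 3%N 0 = 0 by rewrite /u heat_coeff0.
move=> x y xy s t s0 t0 st; rewrite !(heat_kernelE He dr) !gdist_refl.
(* Only the distances 1, 2 and 3 remain. *)
have := gdist_le_diameter e x y; have : gdist e x y != 0%N by rewrite gdist_eq0.
rewrite diam /=; case: (gdist e x y) => [|[|[|[|//]]]] // _ _.
- exact: (ode_ratio1 (ler0n _ _) (ler0n _ _) c2_gt0 Du0 Du1 Du2 Du3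
    u00 u10 u20 u30 s0 t0 st).
- exact: (ode_ratio2 (ler0n _ _) (ler0n _ _) c2_gt0 Du0 Du1 Du2 Du3
    u00 u10 u20 u30 s0 t0 st).
- exact: (ode_ratio3 (ler0n _ _) (ler0n _ _) c2_gt0 Du0 Du1 Du2 Du3
    u00 u10 u20 u30 s0 t0 st).
Qed.
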